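(* Let $n\geq 1$ and let $A\in M_{n,n}(\mathbb{R}_{\geqslant})$ be idempotent for the tropical matrix product, i.e. $A\odot A=A$. Then $A$ satisfies the following conditions for all $1\leq i,k\leq n$: $$A_{ii}\leq 1,$$ $$A_{ik}A_{ki}\leq \min(A_{ii},A_{kk})\quad\text{if } i\neq k.$$
   Context: $\mathbb{R}_{\geqslant}=[0,\infty)$ is the set of nonnegative real numbers, and $M_{n,n}(\mathbb{R}_{\geqslant})$ is the set of $n\times n$ matrices with entries in $\mathbb{R}_{\geqslant}$; $A_{ij}$ denotes the $(i,j)$ entry of $A$. The tropical product is $(A\odot B)_{ij}=\max\{A_{ik}B_{kj}:1\leq k\leq n\}$, with usual products of real numbers on the right. *)

(* Defs.v *)
From HB Require Import structures.
From mathcomp Require Import all_boot all_order all_algebra.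
From mathcomp Require Import reals.

Set Implicit Arguments.
Unset Strict Implicit.
Unset Printing Implicit Defensive.

Import Order.TTheory GRing.Theory Num.Theory.
Local Open Scope ring_scope.

(* The base value 0 of the iterated maximum is neutral on nonnegative entries,
   so on nonempty nonnegative matrices this is the plain maximum over k; it is
   meaningful only for such matrices. *)
Definition tropmul (R : realType) (n : nat) (A B : 'M[R]_n) : 'M[R]_n :=
  \matrix_(i, j) \big[Num.max/0]_(k < n) (A i k * B k j).

(* Main.v *)
Require Import Defs.
From HB Require Import structures.
From mathcomp Require Import all_boot all_order all_algebra.
From mathcomp Require Import reals.

Set Implicit Arguments.
Unset Strict Implicit.
Unset Printing Implicit Defensive.

Import Order.TTheory GRing.Theory Num.Theory.
Local Open Scope ring_scope.

(** A maximum dominates each of its terms, so idempotency gives [A i k * A k j <= A i j] for all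
    [i], [j], [k]. Both conditions are instances of this inequality with [j = i]. *)

Lemma tropmul_ge (R : realType) (n : nat) (A B : 'M[R]_n) (i j k : 'I_n) :
  A i k * B k j <= tropmul A B i j.
Proof. by rewrite mxE; exact: (le_bigmax _ (fun l => A i l * B l j)). Qed.

Theorem lemma2p21 (R : realType) (n : nat) (hn : (1 <= n)%N) (A : 'M[R]_n)
    (hA : A \is a mxOver Num.nneg) (hidem : tropmul A A = A) :
  (forall i : 'I_n, A i i <= 1) /\
  (forall i k : 'I_n, i != k -> A i k * A k i <= Num.min (A i i) (A k k)).
Proof.
have idem_ge i j k : A i k * A k j <= A i j.
  by rewrite -[leRHS](congr1 (fun M : 'M[R]_n => M i j) hidem) tropmul_ge.
split=> [i|i k _].
  rewrite leNgt; apply/negP => A_gt1.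
  (* With all indices equal, the inequality says that the square of [A i i] is at most [A i i],
     impossible for a number above 1. *)
  have := idem_ge i i i; rewrite leNgt => /negP; apply.
  by rewrite ltr_pMr // (lt_trans ltr01).
(* The same product is a path from [i] to [i] through [k] and, once commuted, a path from [k] to [k]
   through [i]. *)
by rewrite le_min idem_ge mulrC idem_ge.
Qed.
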